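(* Let $n\ge 3$ be an integer, let $Z_n=\{0,1,\dots,n-1\}$, and let $t,u\in Z_n$. If $t^2\equiv u \pmod n$, then the groupoid $Z_n(t,u)$ (a member of $Z^{***}(n)$) is an AG-groupoid.
   Context: A groupoid is a set with a binary operation. For $t,u\in Z_n$, $Z_n(t,u)$ denotes the groupoid on $Z_n=\{0,1,\dots,n-1\}$ with operation $a\cdot b = ta+ub \pmod n$ (usual integer addition and multiplication, reduced modulo $n$). The class $Z^{***}(n)$ consists of the groupoids $Z_n(t,u)$ with $t,u\in Z_n$, where $t$ and $u$ need be neither distinct, nor relatively prime, nor nonzero. An AG-groupoid is a groupoid $G$ satisfying the left invertive law $(ab)c=(cb)a$ for all $a,b,c\in G$. *)

(* Defs.v *)
From HB Require Import structures.
From mathcomp Require Import all_boot.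

Set Implicit Arguments.
Unset Strict Implicit.
Unset Printing Implicit Defensive.

Local Open Scope group_scope.

(* A groupoid in the sense of a set with a binary operation is a magmaType. *)
Definition AG_groupoid (G : magmaType) : Prop :=
  forall a b c : G, (a * b) * c = (c * b) * a.

(* The carrier of Z_n(t, u). The parameters t and u are recorded in the type
   so that each pair (t, u) gets its own operation on 'I_n; the class Z***(n)
   is the family of all Zgroupoid t u, with t and u unrestricted in 'I_n. *)
Definition Zgroupoid (n : nat) (t u : 'I_n) : Type := 'I_n.

(* The argument a witnesses 0 < n, so n itself is arbitrary here. *)
Definition Zgroupoid_op (n : nat) (t u a b : 'I_n) : 'I_n :=
  Ordinal (ltn_pmod (t * a + u * b)%N (leq_ltn_trans (leq0n a) (ltn_ord a))).

HB.instance Definition _ (n : nat) (t u : 'I_n) :=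
  hasMul.Build (Zgroupoid t u) (@Zgroupoid_op n t u).

(* Main.v *)
Require Import Defs.
From mathcomp Require Import all_boot.

(** Expanding both sides of the left invertive law modulo [n] gives
    [(a b) c = t^2 a + t u b + u c] and [(c b) a = t^2 c + t u b + u a].
    They differ only by exchanging the coefficients [t^2] and [u] of the outer
    factors, so they agree as soon as [t^2] and [u] are congruent: both become
    [u a + t u b + u c], which is symmetric in [a] and [c]. *)

(** Rewriting [t ^ 2] into [u] puts the product in a form visibly symmetric in
    [a] and [c]; applying this to both sides yields the left invertive law. *)
Lemma modn_left_nested_affine (n t u a b c : nat) :
  t ^ 2 = u %[mod n] ->
  t * ((t * a + u * b) %% n) + u * c = u * (a + c) + t * u * b %[mod n].
Proof.
move=> htu.
rewrite -modnDml modnMmr modnDml mulnDr !mulnA mulnn.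
by rewrite -addnA -modnDml -modnMml htu modnMml modnDml addnA addnAC -mulnDr.
Qed.

Theorem theorem1 (n : nat) (hn : 3 <= n) (t u : 'I_n)
  (htu : t ^ 2 = u %[mod n]) : AG_groupoid (Zgroupoid t u).
Proof.
move=> a b c; apply: val_inj => /=.
by rewrite !modn_left_nested_affine // [c + a]addnC.
Qed.
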